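(* If a graph $G$ is contractible, then $G$ is $6$-colorable (i.e., has a proper vertex coloring with at most $6$ colors).
   Context: All graphs are finite and simple (no loops or multiple edges). Let $G$ and $H$ be graphs with $V(H)\subseteq V(G)$. An $H$-scheme in $G$ is a collection of paths $\{P_{uv}: uv\in E(H)\}$ such that (1) each $P_{uv}$ is a $u,v$-path in $G$ with $V(P_{uv})\cap V(H)=\{u,v\}$, and (2) whenever $e_1,\dots,e_k\in E(H)$ satisfy $V(P_{e_1})\cap\dots\cap V(P_{e_k})\neq\emptyset$, there is a vertex $u\in V(H)$ incident with each of $e_1,\dots,e_k$. $G$ has a rooted $H$-minor if there are pairwise vertex-disjoint connected subgraphs $C_v$ of $G$, one for each $v\in V(H)$, such that $v\in V(C_v)$ for all $v\in V(H)$ and for each edge $uv\in E(H)$ there is an edge of $G$ joining $C_u$ and $C_v$. A graph $H$ is contractible if every graph $G$ with $V(H)\subseteq V(G)$ that contains an $H$-scheme has a rooted $H$-minor. *)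

(* Defs.v *)
From mathcomp Require Import all_boot.

Set Implicit Arguments.
Unset Strict Implicit.
Unset Printing Implicit Defensive.

Record sgraph := SGraph {
  vertex :> finType;
  adj : rel vertex;
  adj_sym : symmetric adj;
  adj_irr : irreflexive adj
}.

Definition edges (G : sgraph) : {set {set G}} :=
  [set [set p.1; p.2] | p : G * G & adj p.1 p.2].

(* A path is a vertex sequence without repetition; since a path in a graph has
   no orientation, a u,v-path may be listed from u to v or from v to u. *)
Definition uv_path (G : sgraph) (u v : G) (p : seq G) : bool :=
  if p is x :: q then
    [&& path (@adj G) x q, uniq p & [set x; last x q] == [set u; v]]
  else false.

Record subgraph (G : sgraph) := Subgraph {
  sub_vertex : {set G};
  sub_adj : rel G;
  sub_adj_sym : symmetric sub_adj;
  sub_adj_vertex : forall x y, sub_adj x y -> x \in sub_vertex;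
  sub_adj_adj : forall x y, sub_adj x y -> adj x y
}.

Definition connected_subgraph (G : sgraph) (C : subgraph G) : Prop :=
  sub_vertex C != set0 /\
  {in sub_vertex C &, forall x y, connect (sub_adj C) x y}.

(* In [scheme] and [rooted_minor], the inclusion of V(H) in V(G) is an injective
   map [i]; it is not required to preserve adjacency. *)

(* Paths are indexed by unordered edges, so that P_uv and P_vu are the same path;
   values of [P] on sets that are not edges of [H] are irrelevant.  The edges
   e_1, ..., e_k (k >= 1) are given as a nonempty set [F]. *)
Definition scheme (H G : sgraph) (i : H -> G) (P : {set H} -> seq G) : Prop :=
  (forall u v : H, adj u v ->
     uv_path (i u) (i v) (P [set u; v]) /\
     [set x in P [set u; v]] :&: [set i w | w : H] = [set i u; i v]) /\
  (forall F : {set {set H}}, F \subset edges H -> F != set0 ->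
     \bigcap_(e in F) [set x in P e] != set0 ->
     exists u : H, forall e, e \in F -> u \in e).

Definition rooted_minor (H G : sgraph) (i : H -> G) : Prop :=
  exists C : H -> subgraph G,
    [/\ forall v, connected_subgraph (C v),
        forall u v, u != v -> [disjoint sub_vertex (C u) & sub_vertex (C v)],
        forall v, i v \in sub_vertex (C v)
      & forall u v, adj u v ->
          exists x y, [/\ x \in sub_vertex (C u), y \in sub_vertex (C v)
                        & adj x y]].

Definition contractible (H : sgraph) : Prop :=
  forall (G : sgraph) (i : H -> G), injective i ->
    (exists P, scheme i P) -> rooted_minor i.

Definition colorable (k : nat) (G : sgraph) : Prop :=
  exists c : G -> 'I_k, forall x y, adj x y -> c x != c y.

(* Main.v *)
(* Suppose that no path of G ending at r meets three neighbours of r at even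
   distance from r along the path.  A depth-first search then 6-colours G: a new
   vertex takes the parity of its depth as first colour component, and as second
   component one of three values that avoids its at most two neighbours of equal
   parity on the current branch.

   Otherwise G contains an odd cycle with a chord that splits it into
   an arc of even length at least 4 and one of odd length at least 3.  Call this
   subgraph X.  Give every vertex i of X a twin i', delete the edges of X, and add
   the edges i j' and i' j' for all edges i j of X.  The paths i, j', i', j and the
   remaining edges form a scheme.  In a rooted minor, each nonempty bag A_i of twins
   contains a neighbour of i.  As X has no triangle, every X-neighbour of an empty
   bag has at least two twins, and since a nonempty independent set of an odd cycle
   has more neighbours than elements, counting the twins leaves no empty bag.  So
   each bag is a single twin s(i), where s is a permutation along the edges of X,
   and following s around X shows that some edge of X is not represented. *)

Require Import Defs.
From mathcomp Require Import all_boot.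
From mathcomp Require Import zify.

Set Implicit Arguments.
Unset Strict Implicit.
Unset Printing Implicit Defensive.

(** * Doubling a subgraph, and the twins in a rooted minor *)

Section Doubling.

Variables (H : sgraph) (I : finType) (f : I -> H) (e : rel I).
Hypotheses (f_inj : injective f) (e_sym : symmetric e) (e_irr : irreflexive e).
Hypothesis e_adj : forall i j, e i j -> adj (f i) (f j).

Definition image_rel (u v : H) : bool :=
  [exists p : I * I, [&& e p.1 p.2, f p.1 == u & f p.2 == v]].

Definition double_adj (x y : H + I) : bool :=
  match x, y with
  | inl u, inl v => adj u v && ~~ image_rel u v
  | inl u, inr j => [exists i, (f i == u) && e i j]
  | inr j, inl u => [exists i, (f i == u) && e i j]
  | inr i, inr j => e i j
  end.

Lemma image_rel_sym : symmetric image_rel.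
Proof.
suff sub u v : image_rel u v -> image_rel v u by move=> u v; apply/idP/idP; exact: sub.
case/existsP=> -[i j] /= /and3P[eij fi fj].
by apply/existsP; exists (j, i); rewrite /= e_sym eij fi fj.
Qed.

Lemma double_adj_sym : symmetric double_adj.
Proof. by move=> [u|i] [v|j] //=; rewrite 1?adj_sym 1?image_rel_sym // e_sym. Qed.

Lemma double_adj_irr : irreflexive double_adj.
Proof. by move=> [u|i] /=; rewrite ?adj_irr. Qed.

Definition double : sgraph := SGraph double_adj_sym double_adj_irr.

Lemma double_adj_lr i j : @adj double (inl (f i)) (inr j) = e i j.
Proof.
apply/existsP/idP => [[k /andP[/eqP/f_inj->]] //|eij].
by exists i; rewrite eqxx.
Qed.

Definition double_path (s : {set H}) : seq double :=
  if [pick p : I * I | e p.1 p.2 && (s == [set f p.1; f p.2])] is Some (i, j)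
  then [:: inl (f i); inr j; inr i; inl (f j)]
  else if [pick p : H * H | s == [set p.1; p.2]] is Some (u, v)
  then [:: inl u; inl v] else [::].

(* [double_path] has to choose an orientation of each edge, hence the new [i], [j]
   (resp. [u], [v]). *)
Variant double_path_spec (s : {set H}) : seq double -> Prop :=
| DoublePathLong i j of e i j & s = [set f i; f j] :
    double_path_spec s [:: inl (f i); inr j; inr i; inl (f j)]
| DoublePathShort u v of adj u v & ~~ image_rel u v & s = [set u; v] :
    double_path_spec s [:: inl u; inl v].

Lemma set2_adj (u v x y : H) : [set u; v] = [set x; y] -> adj u v -> adj x y.
Proof.
move=> E; have: x \in [set u; v] by rewrite E set21.
have: y \in [set u; v] by rewrite E set22.
have: u \in [set x; y] by rewrite -E set21.
have: v \in [set x; y] by rewrite -E set22.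
by rewrite !inE; do 4![case/orP=> /eqP ?]; subst; rewrite // adj_sym.
Qed.

Lemma double_pathP u v : adj u v -> double_path_spec [set u; v] (double_path [set u; v]).
Proof.
move=> uv; rewrite /double_path.
case: pickP => [[i j] /= /andP[eij /eqP E]|no]; first exact: DoublePathLong.
case: pickP => [[x y] /= /eqP E|/(_ (u, v))]; last by rewrite eqxx.
apply: DoublePathShort => //; first exact: set2_adj E uv.
apply/existsP=> -[[i j] /= /and3P[eij /eqP fi /eqP fj]].
by have := no (i, j); rewrite /= eij E fi fj eqxx.
Qed.

(** Projecting twins to their originals keeps a path over the two ends of its edge, so the label of
    a vertex common to several paths is the common end that a scheme requires. *)
Definition double_label (x : double) : H :=
  match x with inl u => u | inr i => f i end.

Lemma double_path_label u v x : adj u v ->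
  x \in double_path [set u; v] -> double_label x \in [set u; v].
Proof.
case/double_pathP=> [i j _ ->|a b _ _ ->]; rewrite !inE.
  by case/or4P=> /eqP-> /=; rewrite eqxx ?orbT.
by case/orP=> /eqP-> /=; rewrite eqxx ?orbT.
Qed.

Lemma double_scheme : @scheme H double inl double_path.
Proof.
split=> [u v uv|F /subsetP FE F0 /set0Pn[x /bigcapP xF]].
  have im2 (a b : H) : [set inl a; inl b] = inl @: [set a; b] :> {set double}.
    by rewrite imsetU1 imset_set1.
  rewrite !im2; have ends (a b : H) : a != b -> (inl a : double) != inl b.
    by apply: contraNneq => -[->].
  case: (double_pathP uv) => [i j eij E|a b ab nab E]; rewrite E -im2.
    have ij : j != i by apply: contraTneq eij => ->; rewrite e_irr.
    split; last first.
      apply/setP=> -[w|k]; rewrite !inE /=; last by rewrite 1?andbC; case: imsetP => [[]|] //=.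
      by rewrite imset_f // andbT.
    have Ppath : path (@adj double) (inl (f i)) [:: inr j; inr i; inl (f j)].
      apply/and4P; split=> //; first by rewrite double_adj_lr.
        by rewrite /adj /= e_sym.
      by rewrite adj_sym double_adj_lr e_sym.
    rewrite /uv_path Ppath /= !im2 E eqxx andbT.
    rewrite !inE /= andbT negb_or (inj_eq (@inr_inj _ _)) ij andbT.
    by apply: ends; rewrite inj_eq // eq_sym.
  split; last first.
    apply/setP=> -[w|k]; rewrite !inE /=; last by [].
    by rewrite imset_f // andbT.
  rewrite /uv_path /= !im2 E eqxx !andbT inE ab nab /=.
  by apply: ends; apply: contraTneq ab => ->; rewrite adj_irr.
exists (double_label x) => s sF; have /imsetP[[u v]] := FE _ sF.
rewrite inE /= => uv E; have := xF _ sF; rewrite E inE.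
exact: double_path_label.
Qed.

(** [A i] collects the twins in the bag of [f i], whose only original vertex is its root; so a path
    inside the bag from the root to a twin starts with a step to a twin. An edge between the bags of
    [f i] and [f j] cannot join the two roots, as that edge was deleted. *)
Lemma double_minor : contractible H ->
  exists A : I -> {set I},
    [/\ forall i j, i != j -> [disjoint A i & A j],
        forall i, A i != set0 -> exists2 k, k \in A i & e i k
      & forall i j, e i j ->
          [\/ exists2 k, k \in A i & e k j, exists2 k, k \in A j & e i k
            | exists k l, [/\ k \in A i, l \in A j & e k l]]].
Proof.
move=> /(_ double inl (@inl_inj _ _) (ex_intro _ _ double_scheme)).
case=> C [Cconn Cdisj Croot Cadj].
have Cdis u v x : x \in sub_vertex (C u) -> x \in sub_vertex (C v) -> u = v.
  by move=> xu xv; apply/eqP; apply: contraT => /Cdisj/disjointFr/(_ xu); rewrite xv.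
have Cl u v : inl u \in sub_vertex (C v) -> u = v by exact: Cdis.
exists (fun i => [set j | inr j \in sub_vertex (C (f i))]); split.
- move=> i j ij; rewrite -setI_eq0; apply: contraNT ij => /set0Pn[k].
  by rewrite !inE => /andP[ki kj]; apply/eqP/f_inj; exact: Cdis ki kj.
- move=> i /set0Pn[j]; rewrite inE => jC; have [_ /(_ _ _ (Croot _) jC)] := Cconn (f i).
  case/connectP=> -[|y p] //= /andP[xy _] _.
  have yC : y \in sub_vertex (C (f i)) by rewrite sub_adj_sym in xy; exact: sub_adj_vertex xy.
  have {xy} := sub_adj_adj xy; case: y yC => [u /Cl-> | k kC].
    by rewrite adj_irr.
  by move=> a; exists k; rewrite ?inE //; rewrite -double_adj_lr.
- move=> i j eij; have [x [y [xC yC]]] := Cadj _ _ (e_adj eij).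
  case: x xC => [u /Cl-> | k kC]; case: y yC => [v /Cl-> | l lC].
  + case/andP=> _ /existsP[]; exists (i, j) => /=; by rewrite eij !eqxx.
  + by move=> a; apply: Or32; exists l; rewrite ?inE // -double_adj_lr.
  + by rewrite adj_sym => a; apply: Or31; exists k; rewrite ?inE // e_sym -double_adj_lr.
  + by move=> a; apply: Or33; exists k, l; rewrite !inE.
Qed.

End Doubling.

(** * Odd cycles with a chord *)

Lemma iter_ordS n k (i : 'I_n) : iter k (@ordS n) i = (i + k) %% n :> nat.
Proof.
elim: k => [|k IHk] /=; first by rewrite addn0 modn_small.
by rewrite IHk -addn1 modnDml -addnA addn1.
Qed.

(** Otherwise every successor of an element of [S] is also a predecessor of one, so [S] is closed
    under double steps. For odd [n], an even number [n + 1] of steps amounts to a single one,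
    against independence. *)
Lemma card_cycle_neighbours n (S : {set 'I_n}) : odd n -> S != set0 ->
  (forall i, i \in S -> ordS i \notin S) ->
  #|S| < #|@ordS n @: S :|: @ord_pred n @: S|.
Proof.
move=> n_odd /set0Pn[i iS] indep; rewrite ltnNge; apply/negP=> leB.
have /eqP predE : @ord_pred n @: S == @ordS n @: S :|: @ord_pred n @: S.
  by rewrite eqEcard subsetUr card_imset ?leB //; exact: can_inj (@ord_predK n).
have step j : j \in S -> ordS (ordS j) \in S.
  move=> jS; have : ordS j \in @ord_pred n @: S by rewrite predE inE imset_f.
  by case/imsetP=> k kS ->; rewrite ord_predK.
have even_step k : iter k.*2 (@ordS n) i \in S by elim: k => // k /step.
have /negP[] := indep i iS; suff <- : iter (uphalf n).*2 (@ordS n) i = ordS i by [].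
apply: ord_inj; rewrite iter_ordS.
have -> : i + (uphalf n).*2 = i.+1 + n by rewrite uphalf_half; lia.
exact: modnDr.
Qed.

(* Meant for [i, j < N]: the cycle [0, ..., N - 1] with the chord [{0, q}]. *)
Definition theta (N q i j : nat) : bool :=
  [|| j == i.+1, i == j.+1, (i == 0) && ((j == N.-1) || (j == q))
    | (j == 0) && ((i == N.-1) || (i == q))].

(** The inner vertices of the arc from 0 to [q] have degree two and all move the same way. Hence [s]
    rotates the cycle [0, ..., q] and loses an edge leaving it, at 0 or at [q]. *)
Lemma theta_permutation N q (s : nat -> nat) : 4 <= q -> q + 3 <= N ->
  (forall i, i < N -> s i < N) ->
  (forall i j, i < N -> j < N -> s i = s j -> i = j) ->
  (forall i, i < N -> theta N q i (s i)) ->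
  (forall i j, i < N -> j < N -> theta N q i j ->
     [|| theta N q (s i) j, theta N q i (s j) | theta N q (s i) (s j)]) -> False.
Proof.
move=> q4 qN slt s_inj s_th s_edge.
have inner i : 0 < i < q -> s i = i.+1 \/ s i = i.-1.
  by move=> iq; have := s_th i; rewrite /theta; lia.
have no_diverge i : 0 < i -> i.+1 < q -> s i = i.-1 -> s i.+1 = i.+2 -> False.
  by move=> i0 iq si si1; have := s_edge i i.+1; rewrite si si1 /theta; lia.
(* By injectivity a swap drives an inner vertex next to the pair away from it; for [i = 1] this is
   3, which is inner since [q >= 4]. *)
have no_swap i : 0 < i -> i.+1 < q -> s i = i.+1 -> s i.+1 = i -> False.
  move=> i0 iq si si1; have [i1|i1] := leqP i 1.
    have iE : i = 1 by lia.
    move: si si1; rewrite {}iE => s1 s2.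
    have [s3|s3] := inner 3 q4; first exact: (no_diverge 2).
    by have := s_inj 1 3; rewrite s1 s3; lia.
  have [|si'|si'] := inner i.-1; first lia.
    by have := s_inj i.-1 i.+1; rewrite si' si1; lia.
  apply: (no_diverge i.-1); [lia | lia | exact: si' |].
  by rewrite prednK // si.
have [|s1|s1] := inner 1; first lia.
  have up i : 0 < i < q -> s i = i.+1.
    elim: i => // -[_ _ //|i IHi] iq.
    have [|//|siS] := inner i.+2; first lia.
    by have := no_swap i.+1; rewrite siS IHi; lia.
  have sq1 : s q.-1 = q by rewrite up; lia.
  have sq2 : s q.-2 = q.-1 by rewrite up; lia.
  have s0 : s 0 = 1.
    have := s_th 0; have := s_edge 0 1; have := s_inj 0 q.-1.
    by rewrite s1 sq1 /theta; lia.
  have sq : s q = 0.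
    have := s_th q; have := s_edge 0 q; have := s_inj q q.-2.
    by rewrite s0 sq2 /theta; lia.
  have := s_th N.-1; have := s_edge 0 N.-1; have := s_inj q N.-1.
  by rewrite s0 sq /theta; lia.
have down i : 0 < i < q -> s i = i.-1.
  elim: i => // -[_ _ //|i IHi] iq.
  have [|siS|//] := inner i.+2; first lia.
  by have := no_diverge i.+1; rewrite siS IHi; lia.
have s2 : s 2 = 1 by rewrite down; lia.
have sq1 : s q.-1 = q.-2 by rewrite down; lia.
have sq : s q = q.-1.
  have := s_th q; have := s_edge q.-1 q; have := s_inj q 1.
  by rewrite s1 sq1 /theta; lia.
have s0 : s 0 = q.
  have := s_th 0; have := s_edge 0 q; have := s_inj 0 2.
  by rewrite s2 sq /theta; lia.
have := s_th q.+1; have := s_edge q q.+1; have := s_inj 0 q.+1.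
by rewrite s0 sq /theta; lia.
Qed.

Lemma theta_not_contractible (H : sgraph) N q (f : 'I_N -> H) :
  odd N -> 4 <= q -> q + 3 <= N -> injective f ->
  (forall i j : 'I_N, theta N q i j -> adj (f i) (f j)) -> ~ contractible H.
Proof.
move=> N_odd q4 qN f_inj f_adj Hc.
pose e (i j : 'I_N) := theta N q i j.
have e_sym : symmetric e by move=> i j; rewrite /e /theta; lia.
have e_irr : irreflexive e by move=> i; rewrite /e /theta; lia.
have no_triangle (i j k : 'I_N) : e i j -> e i k -> e k j -> False.
  by rewrite /e /theta; have := ltn_ord i; have := ltn_ord j; have := ltn_ord k; lia.
have eS (i : 'I_N) : e i (ordS i).
  rewrite /e /theta /=; have := ltn_ord i; rewrite leq_eqVlt => /orP[/eqP iN|lt].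
    have -> : i.+1 %% N = 0 by rewrite iN modnn.
    lia.
  by rewrite modn_small // eqxx.
have [A [Adisj Anbr Aedge]] := double_minor f_inj e_sym e_irr f_adj Hc.
have sumA : \sum_i #|A i| <= N.
  under eq_bigr do rewrite -sum1_card.
  by rewrite -(partition_disjoint_bigcup _ _ Adisj) sum1_card -[leqRHS]card_ord max_card.
have A0 i : A i != set0.
  pose S := [set i | A i == set0]; pose B := @ordS N @: S :|: @ord_pred N @: S.
  have SE j : (j \in S) = (A j == set0) by rewrite inE.
  (* [w] represents the edge [j k] and [w'] is a neighbour of [k]; they differ because there is no
     triangle. *)
  have nS j k : j \in S -> e j k -> 1 < #|A k|.
    rewrite SE => /eqP Aj ejk.
    have [w wk ejw] : exists2 w, w \in A k & e j w.
      by case: (Aedge _ _ ejk) => [[w]||[w [l []]]]; rewrite ?Aj ?inE.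
    have [|w' w'k ekw'] := Anbr k; first by apply/set0Pn; exists w.
    apply/card_gt1P; exists w, w'; split=> //; apply: contraTneq ejw => ->.
    by apply/negP=> ejw'; apply: no_triangle ejk ejw' _; rewrite e_sym.
  apply: contraT => /negPn Ai.
  have ltB : #|S| < #|B|.
    apply: card_cycle_neighbours => //; first by apply/set0Pn; exists i; rewrite SE.
    move=> j jS; rewrite SE; have := nS _ _ jS (eS j); rewrite -card_gt0; lia.
  (* One twin for a nonempty bag and a second one for a neighbour of an empty bag: the sum is
     [N - #|S| + #|B| > N]. *)
  have : \sum_j ((j \in ~: S) + (j \in B)) <= N.
    apply: leq_trans sumA; apply: leq_sum => j _; rewrite [j \in ~: S]inE SE -card_gt0.
    have [|_] := boolP (j \in B); last by rewrite addn0; case: posnP.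
    have two : 1 < #|A j| -> (0 < #|A j|) + true <= #|A j| by case: #|A j| => [|[]].
    case/setUP=> /imsetP[k kS jk]; apply: two; apply: (nS k) => //; rewrite jk //.
    by rewrite e_sym -{2}[k]ord_predK.
  have sumE (D : {set 'I_N}) : \sum_j (j \in D : nat) = #|D|.
    by rewrite -sum1_card [RHS]big_mkcond.
  by rewrite big_split /= !sumE -[leqRHS]card_ord -(cardsC S) addnC leq_add2r leqNgt ltB.
have A1 i : #|A i| = 1.
  apply/eqP; rewrite eqn_leq card_gt0 A0 andbT.
  have : \sum_(j < N | j != i) 1 <= \sum_(j < N | j != i) #|A j|.
    by apply: leq_sum => j _; rewrite card_gt0.
  rewrite sum1_card cardC1 card_ord.
  move: sumA; rewrite (bigD1 i) //=; have := ltn_ord i.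
  by move: (\sum_(_ < N | _) _) #|A i| => X a; lia.
have [g Ag] : exists g : 'I_N -> 'I_N, forall i, A i = [set g i].
  by apply: (@fin_all_exists _ _ (fun i k => A i = [set k])) => i; apply/cards1P; rewrite A1.
(* The permutation [g] read on natural numbers, with default value 0 from [N] on. *)
pose s k := if insub k is Some i then g i : nat else 0.
have sE (i : 'I_N) : s i = g i by rewrite /s valK.
apply: (@theta_permutation N q s) => //.
- by move=> i iN; rewrite (sE (Ordinal iN)).
- move=> i j iN jN; rewrite (sE (Ordinal iN)) (sE (Ordinal jN)) => /ord_inj gij.
  apply/eqP; apply: contraT => ij; have := Adisj (Ordinal iN) (Ordinal jN) ij.
  by rewrite !Ag gij -setI_eq0 setIid -cards_eq0 cards1.
- move=> i iN; rewrite (sE (Ordinal iN)).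
  by have [k] := Anbr _ (A0 (Ordinal iN)); rewrite Ag => /set1P->.
- move=> i j iN jN ij; rewrite (sE (Ordinal iN)) (sE (Ordinal jN)).
  case: (@Aedge (Ordinal iN) (Ordinal jN) ij) => [[k]|[k]|[k [l []]]]; rewrite !Ag.
  + by move/set1P=> -> h; apply/orP; left.
  + by move/set1P=> -> h; apply/or3P; apply: Or32.
  + by move=> /set1P-> /set1P-> h; apply/or3P; apply: Or33.
Qed.

(** * Depth-first colouring *)

(* The distance from [r] to [nth r t k] along [r :: t] is [k + 1]. *)
Definition even_fan_free (H : sgraph) : Prop :=
  forall (r : H) t, path (@adj H) r t -> uniq (r :: t) ->
    count (fun k => odd k && adj r (nth r t k)) (iota 0 (size t)) <= 2.

(* [t] is the branch of the search, deepest vertex first; [U] is the set of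
   unvisited vertices, so popped vertices have no neighbour in [U]. *)
Lemma extend_coloring (H : sgraph) (U : {set H}) t (c : H -> bool * 'I_3) :
    even_fan_free H -> sorted (@adj H) t -> uniq t -> (forall x, x \in t -> x \notin U) ->
    (forall x k, k < size t -> (c (nth x t k)).1 = odd (k + size t)) ->
  exists2 c', forall x, x \notin U -> c' x = c x
    & forall u v, u \in U -> (v \in U) || (v \in t) -> adj u v -> c' u != c' v.
Proof.
move=> fan; have [m] := ubnP #|U|; elim: m => // m IHm in U t c *.
have [->|[r0 r0U] ltU] := set_0Vmem U.
  by move=> _ _ _ _ _; exists c => // u v; rewrite inE.
have extend r s : r \in U -> sorted (@adj H) (r :: s) -> uniq s ->
    (forall x, x \in s -> x \notin U) ->
    (forall x k, k < size s -> (c (nth x s k)).1 = odd (k + size s)) ->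
  exists2 c', forall x, x \notin U -> c' x = c x
    & forall u v, u \in U -> (v \in U) || (v \in s) -> adj u v -> c' u != c' v.
  move=> rU rs s_uniq sU s_par.
  have rNs : r \notin s by apply: contraL rU => /sU.
  (* Odd positions of [s] are at even distance from [r] and share its parity; at most two of them
     hold neighbours of [r], which leaves a second component [a] free. *)
  pose ks := [seq k <- iota 0 (size s) | odd k && adj r (nth r s k)].
  have [a aP] : exists a, a \notin [seq (c (nth r s k)).2 | k <- ks].
    apply/existsP; rewrite -negb_forall; apply/negP=> /forallP sub.
    have := @uniq_leq_size _ (enum 'I_3) _ (enum_uniq _) (fun a _ => sub a).
    rewrite size_enum_ord size_map size_filter; apply/negP; rewrite -leqNgt.
    by apply: fan; rewrite //= rNs.
  pose c1 x := if x == r then (odd (size s).+1, a) else c x.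
  have c1s x : x \in s -> c1 x = c x.
    by rewrite /c1; case: eqP => // ->; rewrite (negPf rNs).
  have [|||||c' c'out c'P] := IHm (U :\ r) (r :: s) c1; rewrite //= ?rNs //.
  - by move: ltU; rewrite (cardsD1 r) rU; lia.
  - by move=> x; rewrite !inE => /predU1P[->|/sU/negPf->]; rewrite ?eqxx ?andbF.
  - move=> x [|k] /= ks'; first by rewrite /c1 eqxx.
    by rewrite c1s ?mem_nth // s_par //; lia.
  have c'r : c' r = (odd (size s).+1, a) by rewrite c'out ?inE ?eqxx // /c1 eqxx.
  exists c' => [x xU|u v uU vUs uv].
    rewrite c'out ?inE ?negb_and ?xU ?orbT // /c1; case: eqP => // xr.
    by rewrite xr rU in xU.
  have [ur|ur] := eqVneq u r; last first.
    apply: c'P => //; first by rewrite !inE ur.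
    by rewrite !inE; case: (v == r).
  rewrite {u}ur in uv uU *; have vr : v != r by apply: contraTneq uv => ->; rewrite adj_irr.
  have [vU|vU] := boolP (v \in U).
    by rewrite eq_sym; apply: c'P; rewrite ?inE ?vr ?eqxx // adj_sym.
  move: vUs; rewrite (negPf vU) /= => vs.
  rewrite c'r c'out ?inE ?(negPf vU) ?andbF // c1s //; apply/eqP=> cv.
  move: aP; rewrite -[a]/((odd (size s).+1, a).2) cv; case/mapP.
  have ltv : index v s < size s by rewrite index_mem.
  exists (index v s); last by rewrite nth_index.
  have := s_par r _ ltv; rewrite mem_filter mem_iota nth_index // -cv uv /= ltv andbT; lia.
(* An empty branch starts a new tree at [r0]; otherwise an unvisited neighbour of the top vertex [w]
   is pushed, or [w] is popped if there is none. *)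
elim: t => [_ _ _ _|w t IHt wt t_uniq tU t_par]; first exact: (extend r0).
have [r /andP[rU wr]|no_r] := pickP [pred r in U | adj w r].
  by apply: (extend r) => //=; rewrite adj_sym wr.
have [||||c' c'out c'P] := IHt.
- by case: (t) wt => // x t' /andP[].
- by case/andP: t_uniq.
- by move=> x xt; apply: tU; rewrite inE xt orbT.
- by move=> x k kt; have := t_par x k.+1 kt; rewrite /= => ->; lia.
exists c' => // u v uU vUt uv; apply: c'P => //.
move: vUt; rewrite inE; case: eqP => // vw; have := no_r u.
by rewrite /= uU adj_sym -vw uv.
Qed.

Lemma even_fan_free_colorable (H : sgraph) : even_fan_free H -> colorable 6 H.
Proof.
move=> fan.
have [//|//|c _ cP] :=
  @extend_coloring H setT [::] (fun _ => (false, ord0)) fan isT isT.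
have card6 : #|{: bool * 'I_3}| = 6 by rewrite card_prod card_bool card_ord.
exists (fun x => cast_ord card6 (enum_rank (c x))) => x y xy.
by rewrite (inj_eq (@cast_ord_inj _ _ _)) (inj_eq enum_rank_inj) cP ?inE.
Qed.

Lemma contractible_even_fan_free (H : sgraph) : contractible H -> even_fan_free H.
Proof.
move=> Hc r t rt rt_uniq; rewrite leqNgt; apply/negP; rewrite -size_filter.
set P := (fun k => _); set ks := filter _ _.
have ksP k : k \in ks -> [/\ odd k, adj r (nth r t k) & k < size t].
  by rewrite mem_filter mem_iota => /andP[/andP[? ?] /andP[_ ?]].
have : sorted ltn ks by apply: sorted_filter (iota_ltn_sorted _ _); exact: ltn_trans.
case: ks ksP => [|k1 [|k2 [|k3 ks]]] //= ksP /and3P[k12 k23 _] _.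
have [[o1 _ _] [o2 a2 _] [o3 a3 l3]] :
  [/\ [/\ odd k1, adj r (nth r t k1) & k1 < size t],
      [/\ odd k2, adj r (nth r t k2) & k2 < size t]
    & [/\ odd k3, adj r (nth r t k3) & k3 < size t]].
  by split; apply: ksP; rewrite !inE eqxx ?orbT.
(* The edge from [r] to position [k3] of [t] closes the cycle and the one to [k2] is the chord;
   indices shift by one since [r] comes first. As [k1 < k2 < k3] are odd, [k2 >= 3] and
   [k3 >= k2 + 2]. *)
apply: (@theta_not_contractible H k3.+2 k2.+1 (fun i => nth r (r :: t) i)); last exact: Hc.
- lia.
- lia.
- lia.
- move=> i j /eqP; rewrite nth_uniq //=; first by move/eqP/ord_inj.
    by have := ltn_ord i; lia.
  by have := ltn_ord j; lia.
have step i : i < size t -> adj (nth r (r :: t) i) (nth r (r :: t) i.+1).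
  exact: (pathP r rt).
move=> i j; have := ltn_ord i; have := ltn_ord j; move: (i : nat) (j : nat) => {}i {}j jN iN.
case/or4P.
- by move/eqP=> jE; rewrite jE; apply: step; lia.
- by move/eqP=> iE; rewrite iE adj_sym; apply: step; lia.
- by case/andP=> /eqP-> /orP[] /eqP->.
- by case/andP=> /eqP-> /orP[] /eqP->; rewrite adj_sym.
Qed.

Theorem theorem7p11 (G : sgraph) (hG : contractible G) : colorable 6 G.
Proof. exact/even_fan_free_colorable/contractible_even_fan_free. Qed.
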